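(* Consider an RBM with observed variables $X\in\{-1,1\}^n$ as in the context, with parameters $d,s,D,\gamma$. Let $\zeta>0$. Fix an observed variable $u$ and a subset $S\subseteq[n]\setminus\{u\}$. Suppose there exists an MRF neighbor $i$ of $u$ with $i\notin S$ and a set $T\subseteq[n]$ with $u,i\in T$ and $|\hat f(T)|\ge\zeta$. Then there exists a subset $I$ of the MRF neighborhood of $u$ with $|I|\le 2^s$ such that \[\nu_{u,I|S}\ge\frac{1}{(4d)^{2^s}}\left(\frac1d\right)^{2^s(2^s+1)}\frac{4\zeta^2(e^{-2\gamma})^{d+D-1}}{d^{4d}2^{d+1}\binom{D}{d-1}\gamma e^{2\gamma}}.\]
   Context: RBM: $\mathbb{P}(X=x,Y=y)\propto\exp(x^TJy+h^Tx+g^Ty)$ over observed $X\in\{-1,1\}^n$, latent $Y\in\{-1,1\}^m$; $d=\max_j|\{i:J_{i,j}\ne0\}|$. The marginal of $X$ is $\propto\exp(f(x))$, $f(x)=\sum_j\rho(J_j\cdot x+g_j)+h^Tx$, $\rho(t)=\log(e^t+e^{-t})$, $J_j$ the $j$-th column of $J$; $f=\sum_{T\subseteq[n]}\hat f(T)\chi_T$, $\chi_T(x)=\prod_{i\in T}x_i$. MRF neighborhood of $u$: all $i\ne u$ with $\hat f(T)\ne0$ for some $T\ni u,i$. $s$: max over $u$ of the number of latent $j$ with $J_{i,j}\ne0$ for some $i$ in the MRF neighborhood of $u$. $D$: max size of an MRF neighborhood; $\gamma=\max_u\sum_{T\ni u}|\hat f(T)|$. For disjoint $\{u\},I,S$: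 $\nu_{u,I|S}:=\mathbb{E}_{R,G}\big[\mathbb{E}_{X_S}|\mathbb{P}(X_u=R,X_I=G|X_S)-\mathbb{P}(X_u=R|X_S)\mathbb{P}(X_I=G|X_S)|\big]$, with $R,G$ independent uniform on $\{-1,1\}$ and $\{-1,1\}^{|I|}$, and all probabilities under the marginal of the RBM. *)

(* Defs.v *)
From mathcomp Require Import all_boot all_order all_algebra.
From mathcomp Require Import reals.
From mathcomp Require Import sequences exp.
Set Implicit Arguments. Unset Strict Implicit. Unset Printing Implicit Defensive.
Import Order.TTheory GRing.Theory Num.Theory.
Local Open Scope ring_scope.

Section RBM.
Variables (R : realType) (n m : nat).
Variables (J : 'M[R]_(n, m)) (h : 'I_n -> R) (g : 'I_m -> R).

Definition spin (b : bool) : R := if b then 1 else -1.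
Definition obs := {ffun 'I_n -> bool}.
Definition lat := {ffun 'I_m -> bool}.

Definition rbm_weight (x : obs) (y : lat) : R :=
  expR (\sum_(i < n) \sum_(j < m) spin (x i) * J i j * spin (y j)
        + \sum_(i < n) h i * spin (x i) + \sum_(j < m) g j * spin (y j)).

Definition rbm_Z : R := \sum_(x : obs) \sum_(y : lat) rbm_weight x y.

Definition PX (x : obs) : R := (\sum_(y : lat) rbm_weight x y) / rbm_Z.

Definition rho (t : R) : R := ln (expR t + expR (- t)).
Definition f (x : obs) : R :=
  \sum_(j < m) rho (\sum_(i < n) J i j * spin (x i) + g j)
  + \sum_(i < n) h i * spin (x i).
Definition chi (T : {set 'I_n}) (x : obs) : R := \prod_(i in T) spin (x i).
Definition fhat (T : {set 'I_n}) : R :=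
  (2 ^+ n)^-1 * \sum_(x : obs) f x * chi T x.

Definition rbm_d : nat := (\max_(j < m) #|[set i : 'I_n | J i j != 0%R]|)%N.
Definition mrf_nbhd (u : 'I_n) : {set 'I_n} :=
  [set i : 'I_n | (i != u) &&
     [exists T : {set 'I_n}, [&& u \in T, i \in T & fhat T != 0]]].
Definition rbm_s : nat :=
  (\max_(u < n) #|[set j : 'I_m | [exists i in mrf_nbhd u, J i j != 0%R]]|)%N.
Definition rbm_D : nat := (\max_(u < n) #|mrf_nbhd u|)%N.
Definition rbm_gamma : R :=
  \big[Num.max/0]_(u < n) \sum_(T : {set 'I_n} | u \in T) `|fhat T|.

Definition probX (A : pred obs) : R := \sum_(x : obs | A x) PX x.
Definition condX (A B : pred obs) : R :=
  probX (fun x => A x && B x) / probX B.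

Definition ev_u (u : 'I_n) (r : bool) : pred obs := fun x => x u == r.
Definition ev_I (I : {set 'I_n}) (G : obs) : pred obs :=
  fun x => [forall i in I, x i == G i].
Definition ev_S (S : {set 'I_n}) (xs : obs) : pred obs :=
  fun x => [forall i in S, x i == xs i].

(* nu_{u,I|S}: R uniform on {-1,1}; G uniform on {-1,1}^I (realised as the
   restriction to I of a uniform element of {-1,1}^n); X_S ~ marginal law *)
Definition nu (u : 'I_n) (I S : {set 'I_n}) : R :=
  2^-1 * (2 ^+ n)^-1 *
  \sum_(r : bool) \sum_(G : obs) \sum_(x : obs) PX x *
    `| condX (fun z => ev_u u r z && ev_I I G z) (ev_S S x)
       - condX (ev_u u r) (ev_S S x) * condX (ev_I I G) (ev_S S x) |.

End RBM.

(* Main.v *)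
Require Import Defs.
From mathcomp Require Import all_boot all_order all_algebra.
From mathcomp Require Import reals.
From mathcomp Require Import sequences exp.
From mathcomp Require Import ring lra zify.
Import Order.TTheory GRing.Theory Num.Theory.
Local Open Scope ring_scope.
Set Implicit Arguments.
Unset Strict Implicit.
Unset Printing Implicit Defensive.

(** Write [G] for the local field at [u], i.e. the sum of [fhat T * chi (T :\ u)]
    over the [T] containing [u], and [c = E[G | X_S]].  Expanding [G] bounds
    [E[(G - c) X_u]] above by [gamma 2^d] times the largest [nu_{u, V | S}] with
    [V = T :\ u :\: S], [fhat T != 0].  Since [E[X_u | X_{-u}] = tanh G] and
    [|G|, |c| <= gamma], the same quantity is at least
    [e^{-2 gamma} / 2 * E[(G - c)^2]].  As [c] does not depend on [x_i], pairing
    each [x] with its flip at [i] bounds this below by [E[(G - G o flip_i)^2]],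
    and changing to the uniform measure, at the price of [e^{-2 gamma}] per
    neighbour of [u], by [zeta^2].

    To replace [V] by a set of size at most [2^s], condition on the at most [s]
    latent variables adjacent to the neighbourhood of [u]: the discrepancy
    [P(X_u, X_V | X_S) - P(X_u | X_S) P(X_V | X_S)] becomes a signed combination
    [Q V] of at most [2^s] products [\prod_(i in V) v_y i] with factors in [0, 1].
    The combination [Q (i |: T) - v_c i * Q T] no longer involves the component
    [c], so by induction on the number of components [Q V] is controlled by the
    values of [Q] at small subsets of [V]. *)

(** * Mixtures of products *)

Section ProductMixtures.
Variables (R : realFieldType) (K I : finType).

Definition mixture (q : K -> R) (v : K -> I -> R) (A : {set K}) (T : {set I}) : R :=
  \sum_(y in A) q y * \prod_(i in T) v y i.

(* [mixture (i |: T) - v c i * mixture T] is again a mixture, in which the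
   component [c] has weight 0. *)
Lemma mixture_eliminate (q : K -> R) (v : K -> I -> R) (A : {set K}) (c : K) i
    (T : {set I}) :
  c \in A -> i \notin T ->
  mixture q v A (i |: T) =
    v c i * mixture q v A T
    + mixture (fun y => q y * (v y i - v c i)) v (A :\ c) T.
Proof.
move=> cA iT; rewrite /mixture !(big_setD1 c cA) /= mulrDr -!addrA mulr_sumr.
rewrite -big_split /= (big_setU1 _ iT) /=; congr (_ + _); first by ring.
by apply: eq_bigr => y _; rewrite (big_setU1 _ iT) /=; ring.
Qed.

(** Induction on the number of components. Eliminating a component leaves a mixture that is at most
    [2 * eps] on small subsets of [T :\ i], hence at most [2 * B * eps] at [T :\ i], with [B] the
    factor of the previous level. Building [T] up one element at a time costs this much per
    element. *)
Lemma mixture_le_small_subsets (q : K -> R) (v : K -> I -> R) (A : {set K})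
    (I0 : {set I}) (d : nat) (eps : R) :
  (forall y i, 0 <= v y i <= 1) -> (#|I0| < d)%N -> 0 <= eps ->
  (forall T : {set I}, T \subset I0 -> (#|T| < #|A|)%N ->
     `|mixture q v A T| <= eps) ->
  `|mixture q v A I0| <= (2 * d%:R) ^+ #|A| * eps.
Proof.
move=> v01; move: {2}#|A| (erefl #|A|) => k; elim: k A I0 q eps => [|k IH] A I0 q eps.
  move/eqP; rewrite cards_eq0 => /eqP -> _ e0 _.
  by rewrite /mixture big_set0 normr0 cards0 expr0 mul1r.
move=> Ak Id e0 small.
have [c cA] : exists c, c \in A by apply/set0Pn; rewrite -cards_eq0 Ak.
have Ack : #|A :\ c| = k by move: (cardsD1 c A); rewrite cA Ak => -[].
have d1 : (1 : R) <= 2 * d%:R.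
  rewrite -[1]/(1%:R) -natrM ler_nat; lia.
have P1 : 1 <= (2 * d%:R) ^+ k :> R by rewrite exprn_ege1.
set B := (2 * d%:R) ^+ k in P1.
(* Since [#|I0| <= d - 1] and [1 <= B], this linear bound at [T = I0] is at most
   [2 * d * B * eps]. *)
suff main (T : {set I}) : T \subset I0 ->
    `|mixture q v A T| <= (1 + 2 * #|T|%:R * B) * eps.
  apply: le_trans (main _ (subxx _)) _; apply: ler_wpM2r => //.
  rewrite Ak exprS -/B.
  have : (#|I0|%:R + 1 : R) <= d%:R by rewrite natr1 ler_nat.
  nra.
move: {2}#|T| (erefl #|T|) => t; elim: t T => [|t IHt] T Tt TI.
  apply: le_trans (small T TI _) _; first by rewrite Tt Ak.
  by rewrite Tt mulr0 mul0r addr0 mul1r.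
have [i iT] : exists i, i \in T by apply/set0Pn; rewrite -cards_eq0 Tt.
have Tit : #|T :\ i| = t by move: (cardsD1 i T); rewrite iT Tt => -[].
have TiI : T :\ i \subset I0 by apply: subset_trans TI; apply: subD1set.
have iTi : i \notin T :\ i by rewrite !inE eqxx.
rewrite -(setD1K iT) (mixture_eliminate _ _ cA iTi) setD1K // Tt -natr1.
have /andP[vi0 vi1] := v01 c i.
have H1 : `|v c i * mixture q v A (T :\ i)| <= (1 + 2 * t%:R * B) * eps.
  rewrite normrM (ger0_norm vi0); have := IHt _ Tit TiI; rewrite Tit => H.
  by apply: le_trans H; rewrite ler_piMl.
have H2 : `|mixture (fun y => q y * (v y i - v c i)) v (A :\ c) (T :\ i)|
    <= B * (2 * eps).
  rewrite /B -Ack; apply: IH => //.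
  - by apply: leq_ltn_trans (subset_leq_card TiI) Id.
  - by rewrite mulr_ge0.
  move=> T' T'T; rewrite Ack => T'k.
  have iT' : i \notin T' by apply: contra iTi; apply: (subsetP T'T).
  (* Read backwards, the elimination identity expresses the reduced mixture through two values of
     the original one on sets of at most [k] elements, each at most [eps] in absolute value. *)
  have /eqP := mixture_eliminate q v cA iT'.
  rewrite addrC -subr_eq => /eqP <-; apply: le_trans (ler_normB _ _) _.
  rewrite mulr_natl mulr2n; apply: lerD.
    apply: small; last by rewrite cardsU1 iT' Ak.
    by rewrite subUset sub1set (subsetP TI) //= (subset_trans T'T).
  rewrite normrM (ger0_norm vi0); apply: le_trans (ler_piMl _ vi1) _ => //.
  apply: small; first by rewrite (subset_trans T'T).
  by rewrite Ak ltnS ltnW.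
apply: le_trans (ler_normD _ _) _; nra.
Qed.

End ProductMixtures.

(** * Spin flips and Fourier expansion *)

Section Flips.
Variables (R : realType) (n : nat).
Implicit Types (x z : obs n) (i j : 'I_n) (T : {set 'I_n}).
Implicit Type phi : obs n -> R.

Definition flip i x : obs n := [ffun k => if k == i then ~~ x k else x k].

Lemma flipK i : involutive (flip i).
Proof. by move=> x; apply/ffunP=> k; rewrite !ffunE; case: eqP => //; rewrite negbK. Qed.

Lemma flipC i j x : flip i (flip j x) = flip j (flip i x).
Proof. by apply/ffunP=> k; rewrite !ffunE; do 2!case: eqP. Qed.

Lemma flip_same i x : flip i x i = ~~ x i.
Proof. by rewrite ffunE eqxx. Qed.

Lemma flip_other i j x : j != i -> flip i x j = x j.
Proof. by rewrite ffunE => /negbTE ->. Qed.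

Lemma sum_flip i phi : \sum_x phi (flip i x) = \sum_x phi x.
Proof. by rewrite [RHS](reindex_inj (can_inj (flipK i))). Qed.

Lemma sum_flip_cond i (A : pred (obs n)) phi :
  \sum_(x | A (flip i x)) phi (flip i x) = \sum_(x | A x) phi x.
Proof. by rewrite [RHS](reindex_inj (can_inj (flipK i))). Qed.

Lemma spinN b : spin R (~~ b) = - spin R b.
Proof. by case: b; rewrite /spin //= opprK. Qed.

Lemma spin_sqr b : spin R b * spin R b = 1.
Proof. by case: b; rewrite /spin ?mulr1 ?mulrNN ?mulr1. Qed.

Lemma chi_flip_in i T x : i \in T -> chi R T (flip i x) = - chi R T x.
Proof.
move=> iT; rewrite /chi !(big_setD1 i iT) /= flip_same spinN mulNr.
congr (- (_ * _)); apply: eq_bigr => k; rewrite !inE => /andP[ki _].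
by rewrite flip_other.
Qed.

Lemma chi_flip_notin i T x : i \notin T -> chi R T (flip i x) = chi R T x.
Proof.
move=> iT; apply: eq_bigr => k kT; rewrite flip_other //.
by apply: contraNneq iT => <-.
Qed.

Lemma chi_sqr T x : chi R T x * chi R T x = 1.
Proof. by rewrite /chi -big_split /= big1 // => i _; rewrite spin_sqr. Qed.

Lemma chi_norm T x : `|chi R T x| = 1.
Proof.
by rewrite /chi normr_prod big1 // => i _; case: (x i); rewrite /spin ?normrN normr1.
Qed.

(** Walk from [x] to [z] one coordinate at a time: each step of [mix] either changes nothing or is a
    single flip. *)
Lemma flip_invariant_const phi x z :
  (forall i y, phi (flip i y) = phi y) -> phi x = phi z.
Proof.
move=> inv.
pose mix (l : seq 'I_n) : obs n := [ffun k => if k \in l then z k else x k].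
have H l : phi (mix l) = phi x.
  elim: l => [|j l <-]; first by congr phi; apply/ffunP=> k; rewrite ffunE.
  have [e|ne] := eqVneq (mix l j) (z j).
    congr phi; apply/ffunP=> k; rewrite !ffunE inE; case: eqP => //= ->.
    by move: e; rewrite ffunE => ->.
  rewrite -(inv j (mix l)); congr phi; apply/ffunP=> k; rewrite !ffunE inE.
  case: eqP => //= ->; move: ne; rewrite ffunE.
  by case: ifP => _; [rewrite eqxx | case: (x j); case: (z j)].
by rewrite -(H (enum 'I_n)); congr phi; apply/ffunP=> k; rewrite ffunE mem_enum.
Qed.

Lemma card_obs : #|{: obs n}| = (2 ^ n)%N.
Proof. by rewrite card_ffun card_bool card_ord. Qed.

Lemma sum_subsets_prod (a : 'I_n -> R) :
  \sum_(T : {set 'I_n}) \prod_(i in T) a i = \prod_i (1 + a i).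
Proof.
under [RHS]eq_bigr do rewrite addrC.
rewrite bigA_distr; apply: eq_bigr => T _; rewrite [RHS]big_mkcond /= big_mkcond.
by [].
Qed.

(** Completeness of the characters: the sum factors over coordinates, and a coordinate where [x] and
    [z] differ contributes [1 - 1 = 0]. *)
Lemma sum_chi2 x z :
  \sum_(T : {set 'I_n}) chi R T x * chi R T z = if x == z then 2 ^+ n else 0.
Proof.
under eq_bigr do rewrite /chi -big_split /=.
rewrite sum_subsets_prod; case: eqP => [->|/eqP ne].
  under eq_bigr do rewrite spin_sqr.
  by rewrite prodr_const card_ord.
have [i ni] : exists i, x i != z i.
  apply/existsP; apply: contraR ne; rewrite negb_exists => /forallP H.
  by apply/eqP/ffunP=> i; apply/eqP; rewrite -[_ == _]negbK H.
rewrite (bigD1 i) //= [1 + _](_ : _ = 0) ?mul0r //.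
by move: ni; case: (x i); case: (z i); rewrite /spin //= ?mulr1 ?mul1r subrr.
Qed.

Lemma fourier_expansion phi x :
  phi x = \sum_(T : {set 'I_n})
    ((2 ^+ n)^-1 * \sum_z phi z * chi R T z) * chi R T x.
Proof.
under eq_bigr do rewrite mulrAC mulr_sumr.
rewrite exchange_big /=.
under eq_bigr => z _.
  under eq_bigr => T _.
    rewrite (_ : _ * _ = (2 ^+ n)^-1 * phi z * (chi R T z * chi R T x)); last by ring.
    over.
  rewrite -mulr_sumr sum_chi2; over.
rewrite (bigD1 x) //= eqxx big1 ?addr0.
  by rewrite mulrAC mulVf ?mul1r // expf_neq0 ?pnatr_eq0.
by move=> z /negbTE ->; rewrite mulr0.
Qed.

Lemma sum_flip_odd i phi : (forall x, phi (flip i x) = - phi x) -> \sum_x phi x = 0.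
Proof.
move=> odd; have := sum_flip i phi; under eq_bigr do rewrite odd.
by rewrite sumrN; lra.
Qed.

End Flips.

(** * The marginal law of the observed variables *)

Section Gibbs.
Variables (R : realType) (n m : nat) (J : 'M[R]_(n, m)).
Variables (h : 'I_n -> R) (g : 'I_m -> R).
Implicit Types (x z : obs n) (u i j : 'I_n) (S T I : {set 'I_n}).
Implicit Types phi psi : obs n -> R.

Local Notation P := (PX J h g).
Local Notation F := (f J h g).
Local Notation fh := (fhat J h g).
Local Notation w := (rbm_weight J h g).
Local Notation gam := (rbm_gamma J h g).
Local Notation N := (mrf_nbhd J h g).

(** For fixed [x] the exponent separates over the latent variables, so the sum over [y] is a product
    of two-term sums, each the exponential of a [rho]. Thus the marginal law is proportional to
    [expR (F x)]. *)
Lemma sum_rbm_weight x : \sum_y w x y = expR (F x).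
Proof.
rewrite /f expRD expR_sum.
have -> : \prod_(k < m) expR (rho (\sum_(i < n) J i k * spin R (x i) + g k))
    = \prod_(k < m) \sum_(b : bool)
        expR (spin R b * (\sum_(i < n) J i k * spin R (x i) + g k)).
  apply: eq_bigr => k _; rewrite big_bool /rho /spin mul1r mulN1r lnK //.
  by rewrite posrE addr_gt0 // expR_gt0.
rewrite bigA_distr_bigA /= mulr_suml; apply: eq_bigr => y _.
rewrite -expR_sum -expRD; congr expR; rewrite exchange_big /= -addrA addrCA addrC.
congr (_ + _); rewrite -big_split /=; apply: eq_bigr => k _.
rewrite mulrDr mulr_sumr; congr (_ + _); last by rewrite mulrC.
by apply: eq_bigr => i _; ring.
Qed.

Lemma rbm_Z_gt0 : 0 < rbm_Z J h g.
Proof.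
rewrite /rbm_Z; under eq_bigr do rewrite sum_rbm_weight.
rewrite (bigD1 [ffun=> true]) //= ltr_pwDl ?expR_gt0 // sumr_ge0 // => x _.
exact: expR_ge0.
Qed.

Lemma PX_gt0 x : 0 < P x.
Proof. by rewrite /PX sum_rbm_weight divr_gt0 ?expR_gt0 ?rbm_Z_gt0. Qed.

Lemma sum_PX : \sum_x P x = 1.
Proof. by rewrite /PX -mulr_suml divff // gt_eqF ?rbm_Z_gt0. Qed.

Lemma f_fourier x : F x = \sum_(T : {set 'I_n}) fh T * chi R T x.
Proof. exact: fourier_expansion. Qed.

Lemma fhat_sum_le_gamma i : \sum_(T : {set 'I_n} | i \in T) `|fh T| <= gam.
Proof. by rewrite /rbm_gamma (bigD1 i) //= le_max lexx. Qed.

(** A summand of [f] that ignores some coordinate [j] of [T] has zero coefficient at [T], by pairing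
    [x] with its flip at [j]. Linear summands see one coordinate and each latent variable at most
    [rbm_d J]. *)
Lemma fhat_eq0_of_order T : (1 < #|T|)%N -> (rbm_d J < #|T|)%N -> fh T = 0.
Proof.
move=> T2 Td; rewrite /fhat; apply/eqP; rewrite mulf_eq0; apply/orP; right; apply/eqP.
rewrite /f; under eq_bigr do rewrite mulrDl !mulr_suml.
rewrite big_split /= exchange_big /= big1 ?add0r => [|k _].
  rewrite exchange_big big1 //= => i _.
  have [j jT ji] : exists2 j, j \in T & j != i.
    have /card_gt0P[j] : (0 < #|T :\ i|)%N.
      rewrite -(ltn_add2l (i \in T)) -cardsD1 addn0.
      by apply: leq_ltn_trans T2; case: (i \in T).
    by rewrite !inE => /andP[ji jT]; exists j.
  apply: (sum_flip_odd (i := j)) => x.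
  by rewrite chi_flip_in // flip_other 1?eq_sym // mulrN.
have [j jT /eqP jk] : exists2 j, j \in T & J j k == 0.
  apply/exists_inP; apply: contraLR Td; rewrite negb_exists_in -leqNgt => /forall_inP H.
  apply: leq_trans (leq_bigmax_cond (F := fun k => #|[set i | J i k != 0]|) k isT).
  by apply: subset_leq_card; apply/subsetP => i iT; rewrite inE H.
apply: (sum_flip_odd (i := j)) => x; rewrite chi_flip_in // mulrN.
suff -> : \sum_(i < n) J i k * spin R (flip j x i)
    = \sum_(i < n) J i k * spin R (x i) by [].
apply: eq_bigr => i _.
by have [->|ij] := eqVneq i j; [rewrite jk !mul0r | rewrite flip_other].
Qed.

(* [f x = spin (x u) * local_field u x] up to terms that do not involve [x u]. *)
Definition local_field u x : R := \sum_(T : {set 'I_n} | u \in T) fh T * chi R (T :\ u) x.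

Lemma local_field_le u x : `|local_field u x| <= gam.
Proof.
apply: le_trans (ler_norm_sum _ _ _) _; apply: le_trans (fhat_sum_le_gamma u).
by apply: ler_sum => T _; rewrite normrM chi_norm mulr1.
Qed.

Lemma f_flip u x : F (flip u x) = F x - 2 * spin R (x u) * local_field u x.
Proof.
rewrite !f_fourier (bigID (fun T : {set 'I_n} => u \in T)) /=.
rewrite [in RHS](bigID (fun T : {set 'I_n} => u \in T)) /=.
rewrite [in RHS]addrAC; congr (_ + _); last first.
  by apply: eq_bigr => T uT; rewrite chi_flip_notin.
rewrite /local_field mulr_sumr -sumrB; apply: eq_bigr => T uT.
by rewrite chi_flip_in // /chi (big_setD1 u uT) /=; ring.
Qed.

Lemma local_field_flip_same u x : local_field u (flip u x) = local_field u x.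
Proof. by apply: eq_bigr => T uT; rewrite chi_flip_notin // !inE eqxx. Qed.

Lemma local_field_flip_out u j x :
  j != u -> j \notin N u -> local_field u (flip j x) = local_field u x.
Proof.
move=> ju jN; apply: eq_bigr => T uT.
have [jT|jT] := boolP (j \in T); last by rewrite chi_flip_notin // !inE negb_and jT orbT.
suff -> : fh T = 0 by rewrite !mul0r.
apply/eqP; apply: contraNT jN => fT; rewrite inE ju /=.
by apply/existsP; exists T; rewrite uT jT.
Qed.

Lemma PX_flip u x :
  P (flip u x) = P x * expR (- (2 * spin R (x u) * local_field u x)).
Proof. by rewrite /PX !sum_rbm_weight f_flip expRD; ring. Qed.

(** A flip changes the log-density by twice a local field, which is at most [gam] in absolute
    value. *)
Lemma PX_flip_le u x : P x <= expR (2 * gam) * P (flip u x).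
Proof.
rewrite PX_flip mulrCA; apply: ler_peMr; first exact/ltW/PX_gt0.
rewrite -expRD -[leLHS]expR0 ler_expR.
have := local_field_le u x; rewrite ler_norml => /andP[? ?].
by case: (x u); rewrite /spin; lra.
Qed.

Lemma gamma_ge0 u : 0 <= gam.
Proof.
by apply: le_trans (fhat_sum_le_gamma u); apply: sumr_ge0 => T _; apply: normr_ge0.
Qed.

(** The list [l] holds the coordinates on which [phi] may depend. Averaging [phi] over the flip at
    [j] removes [j] from the list, keeps the uniform mean, and raises the mean under [P] by at most
    a factor [expR (2 * gam)]. Once the list is empty, [phi] is constant. *)
Lemma expectation_ge_uniform (l : seq 'I_n) phi :
  0 <= gam -> (forall x, 0 <= phi x) ->
  (forall j x, j \notin l -> phi (flip j x) = phi x) ->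
  expR (- (2 * gam)) ^+ size l * ((2 ^+ n)^-1 * \sum_x phi x)
    <= \sum_x P x * phi x.
Proof.
move=> gam0; elim: l phi => [|j l IH] phi phi0 inv.
  have c x : phi x = phi [ffun=> true] by apply: flip_invariant_const => *; apply: inv.
  under eq_bigr do rewrite c.
  under [leRHS]eq_bigr do rewrite c.
  rewrite -mulr_suml sum_PX mul1r expr0 mul1r sumr_const card_obs -[phi _ *+ _]mulr_natl natrX.
  by rewrite mulKf // expf_neq0 // pnatr_eq0.
pose A x := 2^-1 * (phi x + phi (flip j x)).
have sA : \sum_x phi x = \sum_x A x.
  by rewrite /A -mulr_sumr big_split /= sum_flip; lra.
have {}IH : expR (- (2 * gam)) ^+ size l * ((2 ^+ n)^-1 * \sum_x A x)
    <= \sum_x P x * A x.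
  apply: IH => [x|k x kl]; first by rewrite mulr_ge0 ?invr_ge0 ?addr_ge0.
  have [->|kj] := eqVneq k j; first by rewrite /A flipK addrC.
  by rewrite /A (flipC j) !(inv k) // inE negb_or kj.
rewrite sA /= exprS -mulrA; apply: le_trans (ler_wpM2l (expR_ge0 _) IH) _.
rewrite expRN ler_pdivrMl ?expR_gt0 //.
have -> : \sum_x P x * A x = 2^-1 * \sum_x (P x + P (flip j x)) * phi x.
  under [in RHS]eq_bigr do rewrite mulrDl.
  rewrite big_split /= -(sum_flip j (fun x => P (flip j x) * phi x)) mulrDr !mulr_sumr.
  by rewrite -big_split /=; apply: eq_bigr => x _; rewrite flipK /A; ring.
rewrite !mulr_sumr; apply: ler_sum => x _.
rewrite mulrA [leRHS]mulrA; apply: ler_wpM2r => //.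
have := PX_flip_le j (flip j x); rewrite flipK.
have : 1 <= expR (2 * gam) by rewrite -[leLHS]expR0 ler_expR mulr_ge0.
have := PX_gt0 x; nra.
Qed.

(** Bessel's inequality for the single character [chi W], at which the flip difference of the local
    field has coefficient [2 * fh T]. *)
Lemma sum_sqr_flip_local_field_ge u i T :
  u \in T -> i \in T -> i != u ->
  4 * fh T ^+ 2
    <= (2 ^+ n)^-1 * \sum_x (local_field u x - local_field u (flip i x)) ^+ 2.
Proof.
move=> uT iT iu; set G := local_field u; set W := T :\ u.
have iW : i \in W by rewrite !inE iu.
have c2 : (2 ^+ n : R) != 0 by rewrite expf_neq0 // pnatr_eq0.
(* The coefficient of [G] at [W] is that of [f] at [T], read off from [F x - F (flip u x)]. *)
have sG : \sum_x G x * chi R W x = 2 ^+ n * fh T.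
  rewrite /fhat mulVKf //.
  have e x : F x * chi R T x - F (flip u x) * chi R T x = 2 * (G x * chi R W x).
    rewrite f_flip /chi (big_setD1 u uT) /= -/W -/G.
    have := spin_sqr R (x u); set s := spin R _; set p := \prod_(_ in _) _ => ss.
    rewrite (_ : _ - _ = 2 * G x * p * (s * s)); last by ring.
    by rewrite ss; ring.
  have : 2 * (\sum_x G x * chi R W x) = \sum_x (F x * chi R T x - F (flip u x) * chi R T x).
    by rewrite mulr_sumr; apply: eq_bigr => x _; rewrite e.
  rewrite sumrB -(sum_flip u (fun x => F (flip u x) * _)).
  under [X in _ - X]eq_bigr do rewrite flipK chi_flip_in // mulrN.
  by rewrite sumrN; lra.
pose D x := G x - G (flip i x).
(* As [i] lies in [W], the flip at [i] negates [chi W], so both halves of [D] contribute equally. *)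
have sD : \sum_x D x * chi R W x = 2 * (2 ^+ n * fh T).
  rewrite -sG /D; under eq_bigr do rewrite mulrBl.
  rewrite sumrB -(sum_flip i (fun x => G (flip i x) * _)).
  under [X in _ - X]eq_bigr do rewrite flipK chi_flip_in // mulrN.
  by rewrite sumrN; ring.
have : 0 <= (2 ^+ n)^-1 * \sum_x (D x - 2 * fh T * chi R W x) ^+ 2.
  by rewrite mulr_ge0 ?invr_ge0 ?exprn_ge0 // sumr_ge0 // => x _; rewrite sqr_ge0.
have -> : \sum_x (D x - 2 * fh T * chi R W x) ^+ 2
    = \sum_x D x ^+ 2 - 4 * fh T * (\sum_x D x * chi R W x)
      + 2 ^+ n * (4 * fh T ^+ 2).
  have -> : 2 ^+ n * (4 * fh T ^+ 2) = \sum_(x : obs n) 4 * fh T ^+ 2.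
    by rewrite sumr_const card_obs -[RHS]mulr_natl natrX.
  rewrite mulr_sumr -sumrB -big_split /=; apply: eq_bigr => x _.
  have := chi_sqr R W x; set s := chi _ _ _ => ss.
  rewrite (_ : 4 * fh T ^+ 2 = 4 * fh T ^+ 2 * (s * s)); last by rewrite ss mulr1.
  by ring.
rewrite sD mulrDr mulrBr mulKf //.
rewrite [X in _ - X](_ : _ = 8 * fh T ^+ 2 * ((2 ^+ n)^-1 * 2 ^+ n)); last by ring.
rewrite mulVf // mulr1; lra.
Qed.

End Gibbs.

(** * Conditional covariances and [nu] *)

Section HyperbolicTangent.
Variable R : realType.
Implicit Types a b c : R.

Definition tanhR a : R := (expR a - expR (- a)) / (expR a + expR (- a)).

Lemma expR_sub_opp_ge a : 0 <= a -> a <= expR a - expR (- a).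
Proof.
move=> a0; have := expR_ge1Dx a.
have : expR (- a) <= 1 by rewrite -expR0 ler_expR oppr_le0.
lra.
Qed.

(** The difference of the tangents is [sinh (a - b) / (cosh a * cosh b)]; for [b <= a] the numerator
    is at least [(a - b) / 2], and each [cosh] is at most [expR c]. *)
Lemma tanhR_expansive a b c :
  `|a| <= c -> `|b| <= c ->
  2^-1 * expR (- (2 * c)) * (a - b) ^+ 2 <= (a - b) * (tanhR a - tanhR b).
Proof.
wlog ab : a b / b <= a => [H|] ha hb.
  have [/H|/ltW /H] := lerP b a; first exact.
  by move=> /(_ hb ha); rewrite -sqrrN opprB -[leRHS]mulrNN !opprB.
have cosh_le y : `|y| <= c -> expR y + expR (- y) <= 2 * expR c.
  rewrite ler_norml => /andP[y1 y2].
  have : expR y <= expR c by rewrite ler_expR.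
  have : expR (- y) <= expR c by rewrite ler_expR lerNl.
  lra.
have ca := cosh_le _ ha; have cb := cosh_le _ hb.
have pa : 0 < expR a + expR (- a) by rewrite addr_gt0 ?expR_gt0.
have pb : 0 < expR b + expR (- b) by rewrite addr_gt0 ?expR_gt0.
have t0 : 0 <= a - b by rewrite subr_ge0.
have sinh := expR_sub_opp_ge t0.
have -> : tanhR a - tanhR b = 2 * (expR (a - b) - expR (- (a - b)))
    / ((expR a + expR (- a)) * (expR b + expR (- b))).
  rewrite /tanhR; move: pa pb; rewrite opprB !expRD !expRN => pa pb.
  have A0 : expR a != 0 by rewrite gt_eqF ?expR_gt0.
  have B0 : expR b != 0 by rewrite gt_eqF ?expR_gt0.
  by field; rewrite ?A0 ?B0 -?expr2 ?gt_eqF ?addr_gt0 ?exprn_gt0 ?expR_gt0.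
rewrite expr2 mulrCA; apply: ler_wpM2l => //.
rewrite ler_pdivlMr ?mulr_gt0 //.
have e1 : (expR a + expR (- a)) * (expR b + expR (- b)) <= 4 * expR (2 * c).
  have -> : 4 * expR (2 * c) = (2 * expR c) * (2 * expR c).
    by rewrite -[2 * c]/(2%:R * c) [2%:R * c]mulr_natl mulr2n expRD; ring.
  by apply: ler_pM => //; exact: ltW.
have e2 : expR (- (2 * c)) * expR (2 * c) = 1 by rewrite -expRD addNr expR0.
have e3 : 0 < expR (- (2 * c)) by rewrite expR_gt0.
apply: (@le_trans _ _ (2^-1 * expR (- (2 * c)) * (a - b) * (4 * expR (2 * c)))).
  by apply: ler_wpM2l => //; rewrite !mulr_ge0 ?invr_ge0 ?expR_ge0.
rewrite (_ : _ * (4 * _) = 2 * (expR (- (2 * c)) * expR (2 * c)) * (a - b)).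
  by rewrite e2; lra.
by field.
Qed.

End HyperbolicTangent.

(** * Conditional expectations and covariances given the spins in [S] *)

Section Conditioning.
Variables (R : realType) (n m : nat) (J : 'M[R]_(n, m)).
Variables (h : 'I_n -> R) (g : 'I_m -> R).
Implicit Types (x z : obs n) (u i j : 'I_n) (S T I V W : {set 'I_n}).
Implicit Types phi psi c : obs n -> R.

Local Notation P := (PX J h g).
Local Notation fh := (fhat J h g).
Local Notation gam := (rbm_gamma J h g).
Local Notation N := (mrf_nbhd J h g).
Local Notation field := (local_field J h g).

Lemma ev_S_refl S x : ev_S S x x.
Proof. by apply/forall_inP. Qed.

Lemma ev_S_sym S x z : ev_S S x z = ev_S S z x.
Proof. by apply: eq_forallb_in => i _; rewrite eq_sym. Qed.

Lemma ev_S_eq S x z y : ev_S S x z -> ev_S S z y = ev_S S x y.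
Proof. by move=> /forall_inP H; apply: eq_forallb_in => i /H /eqP ->. Qed.

Lemma ev_S_flip S x z i : i \notin S -> ev_S S x (flip i z) = ev_S S x z.
Proof.
move=> iS; apply: eq_forallb_in => k kS; rewrite flip_other //.
by apply: contraNneq iS => <-.
Qed.

(** The conditional expectation of [phi] given [X_S], kept as a function of the whole configuration;
    it is constant on configurations that agree on [S]. *)
Definition condE S phi x : R :=
  (\sum_(z | ev_S S x z) P z * phi z) / probX J h g (ev_S S x).

Lemma probX_ev_S_gt0 S x : 0 < probX J h g (ev_S S x).
Proof.
rewrite /probX (bigD1 x) ?ev_S_refl //= ltr_pwDl ?PX_gt0 // sumr_ge0 // => z _.
exact/ltW/PX_gt0.
Qed.

Lemma condE_class S phi x z : ev_S S x z -> condE S phi z = condE S phi x.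
Proof.
by move=> xz; rewrite /condE /probX; congr (_ / _); apply: eq_bigl => y; apply: ev_S_eq.
Qed.

Lemma eq_condE S phi psi x :
  (forall z, ev_S S x z -> phi z = psi z) -> condE S phi x = condE S psi x.
Proof. by move=> e; rewrite /condE; congr (_ / _); apply: eq_bigr => z /e ->. Qed.

Lemma condE_scale S a phi x : condE S (fun z => a * phi z) x = a * condE S phi x.
Proof.
by rewrite /condE mulrA mulr_sumr; congr (_ / _); apply: eq_bigr => z _; rewrite mulrCA.
Qed.

Lemma condE_sum S (K : finType) (A : pred K) (F : K -> obs n -> R) x :
  condE S (fun z => \sum_(k | A k) F k z) x = \sum_(k | A k) condE S (F k) x.
Proof.
rewrite /condE -mulr_suml exchange_big /=; congr (_ / _).
by apply: eq_bigr => z _; rewrite mulr_sumr.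
Qed.

Lemma condX_condE S (A : pred (obs n)) x :
  condX J h g A (ev_S S x) = condE S (fun z => (A z)%:R) x.
Proof.
rewrite /condX /condE; congr (_ / _); rewrite /probX big_mkcond [RHS]big_mkcond /=.
by apply: eq_bigr => z _; case: (A z); case: (ev_S _ _ _); rewrite ?mulr0 ?mulr1.
Qed.

(** Tower property. Both sides come from one double sum over pairs that agree on [S], and summing
    out [x] cancels the normalisation. *)
Lemma sum_condE S c phi :
  (forall x z, ev_S S x z -> c z = c x) ->
  \sum_x P x * (c x * condE S phi x) = \sum_x P x * (c x * phi x).
Proof.
move=> cS.
transitivity (\sum_x \sum_(z | ev_S S x z)
    P x * P z * (c z * phi z) / probX J h g (ev_S S z)).
  apply: eq_bigr => x _; rewrite /condE mulrA mulrA mulr_sumr mulr_suml.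
  apply: eq_bigr => z xz; rewrite (cS _ _ xz).
  rewrite -(_ : probX J h g (ev_S S x) = probX J h g (ev_S S z)).
    by ring.
  by apply: eq_bigl => y; rewrite (ev_S_eq _ xz).
rewrite (exchange_big_dep predT) //=; apply: eq_bigr => z _.
under eq_bigl do rewrite ev_S_sym.
rewrite -mulr_suml -mulr_suml -mulr_suml -/(probX J h g (ev_S S z)).
by field; rewrite gt_eqF ?probX_ev_S_gt0.
Qed.

Definition condcov S phi psi x : R :=
  condE S (fun z => phi z * psi z) x - condE S phi x * condE S psi x.

Lemma condcov_sum S (K : finType) (A : pred K) (F : K -> obs n -> R) psi x :
  condcov S (fun z => \sum_(k | A k) F k z) psi x
  = \sum_(k | A k) condcov S (F k) psi x.
Proof.
rewrite /condcov condE_sum sumrB mulr_suml -condE_sum; congr (_ - _).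
by apply: eq_condE => z _; rewrite mulr_suml.
Qed.

Lemma condcov_scale S a phi psi x :
  condcov S (fun z => a * phi z) psi x = a * condcov S phi psi x.
Proof.
rewrite /condcov mulrBr; congr (_ - _); last by rewrite condE_scale; ring.
by rewrite -condE_scale; apply: eq_condE => z _; rewrite mulrA.
Qed.

Lemma condcovC S phi psi x : condcov S phi psi x = condcov S psi phi x.
Proof.
by rewrite /condcov mulrC; congr (_ - _); apply: eq_condE => z _; rewrite mulrC.
Qed.

Lemma eq_condcov S phi phi' psi x :
  (forall z, ev_S S x z -> phi z = phi' z) -> condcov S phi psi x = condcov S phi' psi x.
Proof.
move=> e; rewrite /condcov (eq_condE e); congr (_ - _).
by apply: eq_condE => z /e ->.
Qed.

(** By the tower property it is enough to centre one of the two factors. *)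
Lemma sum_condcov S phi psi :
  \sum_x P x * condcov S phi psi x
  = \sum_x P x * ((phi x - condE S phi x) * psi x).
Proof.
have e1 : \sum_x P x * condE S (fun z => phi z * psi z) x
    = \sum_x P x * (phi x * psi x).
  rewrite -(eq_bigr _ (fun x _ => congr1 (fun t => P x * t) (mul1r _))).
  rewrite (@sum_condE S (fun=> 1)) //.
  by apply: eq_bigr => x _; rewrite mul1r.
have e2 := sum_condE (c := condE S phi) psi (@condE_class S phi).
under eq_bigr do rewrite /condcov mulrBr.
under [in RHS]eq_bigr do rewrite mulrBl mulrBr.
by rewrite !sumrB e1 e2.
Qed.

(** The signed quantity inside the absolute value of [nu]. *)
Definition discrepancy S u I r (G x : obs n) : R :=
  condX J h g (fun z => ev_u u r z && ev_I I G z) (ev_S S x)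
  - condX J h g (ev_u u r) (ev_S S x) * condX J h g (ev_I I G) (ev_S S x).

Lemma discrepancy_condcov S u I r G x :
  discrepancy S u I r G x
  = condcov S (fun z => (ev_u u r z)%:R) (fun z => (ev_I I G z)%:R) x.
Proof.
rewrite /discrepancy /condcov !condX_condE; congr (_ - _).
by apply: eq_condE => z _; rewrite -natrM mulnb.
Qed.

Lemma card_agreeing V z :
  2 ^+ #|V| * \sum_(G : obs n) (ev_I V G z)%:R = 2 ^+ n :> R.
Proof.
have -> : \sum_(G : obs n) (ev_I V G z)%:R
    = \sum_(G : obs n) \prod_i (if i \in V then (z i == G i)%:R else 1) :> R.
  apply: eq_bigr => G _; rewrite -big_mkcond /=.
  have [/forall_inP H|] := boolP (ev_I V G z).
    by rewrite big1 // => i /H ->.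
  rewrite negb_forall => /existsP[i]; rewrite negb_imply => /andP[iV /negbTE ni].
  by rewrite (bigD1 i) //= ni mul0r.
rewrite -(bigA_distr_bigA (fun i (b : bool) => if i \in V then (z i == b)%:R else 1)) /=.
rewrite -prodr_const [\prod_(i in V) _]big_mkcond -big_split /=.
rewrite (eq_bigr (fun=> 2)) ?prodr_const ?card_ord // => i _.
rewrite big_bool /=; case: ifP => _; last by rewrite mul1r.
by case: (z i); rewrite /= ?addr0 ?add0r mulr1.
Qed.

(** Here [G] ranges over full configurations, so each pattern on [V] occurs [2 ^ (n - #|V|)] times;
    the prefactor corrects for this. *)
Lemma chi_ev V z :
  chi R V z = 2 ^+ #|V| / 2 ^+ n * \sum_(G : obs n) chi R V G * (ev_I V G z)%:R.
Proof.
have -> : \sum_(G : obs n) chi R V G * (ev_I V G z)%:R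
    = chi R V z * \sum_(G : obs n) (ev_I V G z)%:R.
  rewrite mulr_sumr; apply: eq_bigr => G _.
  have [/forall_inP H|_] := boolP (ev_I V G z); last by rewrite !mulr0.
  by congr (_ * _); apply: eq_bigr => i /H /eqP ->.
by rewrite mulrCA [X in _ * X]mulrAC card_agreeing divff ?mulr1 // expf_neq0 // pnatr_eq0.
Qed.

Lemma spin_ev u z : spin R (z u) = \sum_(r : bool) spin R r * (ev_u u r z)%:R.
Proof. by rewrite big_bool /ev_u; case: (z u); rewrite /= !(mulr0, mulr1, addr0, add0r). Qed.

(** Expanding the character and the spin into indicators turns the covariance into a signed sum of
    discrepancies. Comparing the prefactor [2 ^ #|V| / 2 ^ n] with the normalisation
    [1 / (2 * 2 ^ n)] of [nu] gives the power of 2. *)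
Lemma sum_condcov_chi_le_nu S u V :
  \sum_x P x * `|condcov S (chi R V) (fun z => spin R (z u)) x|
    <= 2 ^+ #|V|.+1 * nu J h g u V S.
Proof.
have e x : condcov S (chi R V) (fun z => spin R (z u)) x
    = 2 ^+ #|V| / 2 ^+ n * \sum_r \sum_G spin R r * chi R V G * discrepancy S u V r G x.
  rewrite (@eq_condcov _ _ (fun z => 2 ^+ #|V| / 2 ^+ n *
    \sum_(G : obs n) chi R V G * (ev_I V G z)%:R)); last by move=> z _; rewrite -chi_ev.
  rewrite condcov_scale condcov_sum exchange_big /=; congr (_ * _).
  apply: eq_bigr => G _; rewrite condcov_scale condcovC.
  rewrite (@eq_condcov _ _ (fun z => \sum_(r : bool) spin R r * (ev_u u r z)%:R)); last first.
    by move=> z _; rewrite -spin_ev.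
  rewrite condcov_sum mulr_sumr; apply: eq_bigr => r _.
  by rewrite condcov_scale discrepancy_condcov; ring.
have c0 : 0 <= 2 ^+ #|V| / 2 ^+ n :> R by rewrite divr_ge0 ?exprn_ge0.
apply: (@le_trans _ _ (\sum_x P x * (2 ^+ #|V| / 2 ^+ n *
    \sum_r \sum_G `|discrepancy S u V r G x|))).
  apply: ler_sum => x _; apply: ler_wpM2l; first exact/ltW/PX_gt0.
  rewrite e normrM (ger0_norm c0); apply: ler_wpM2l => //.
  apply: le_trans (ler_norm_sum _ _ _) _; apply: ler_sum => r _.
  apply: le_trans (ler_norm_sum _ _ _) _; apply: ler_sum => G _.
  by rewrite !normrM chi_norm mulr1; case: r; rewrite /spin ?normrN normr1 mul1r.
rewrite /nu -/(discrepancy _ _ _ _ _ _).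
have -> : \sum_r \sum_G \sum_x P x * `|discrepancy S u V r G x|
    = \sum_x P x * \sum_r \sum_G `|discrepancy S u V r G x|.
  under [RHS]eq_bigr do rewrite mulr_sumr.
  rewrite [RHS]exchange_big /=; apply: eq_bigr => r _.
  rewrite exchange_big /=; apply: eq_bigr => x _.
  by rewrite mulr_sumr.
rewrite mulr_sumr exprS le_eqVlt; apply/orP; left; apply/eqP.
rewrite [LHS](eq_bigr (fun x => 2 ^+ #|V| / 2 ^+ n *
  (P x * \sum_r \sum_G `|discrepancy S u V r G x|))); last by move=> x _; rewrite mulrCA.
rewrite [RHS]mulr_sumr; apply: eq_bigr => x _; rewrite !mulrA; congr (_ * _ * _).
by field; rewrite expf_neq0 // pnatr_eq0.
Qed.

(** Given [X_S], the part of the character inside [S] is a fixed sign. *)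
Lemma norm_condcov_chi S W psi x :
  `|condcov S (chi R W) psi x| = `|condcov S (chi R (W :\: S)) psi x|.
Proof.
rewrite (@eq_condcov _ _ (fun z => chi R (W :&: S) x * chi R (W :\: S) z)).
  by rewrite condcov_scale normrM chi_norm mul1r.
move=> z /forall_inP H; rewrite {1}/chi (big_setID S) /=; congr (_ * _).
by apply: eq_bigr => i; rewrite inE => /andP[_ /H /eqP ->].
Qed.

Lemma sum_condcov_field_le_nu S u :
  \sum_x P x * condcov S (field u) (fun z => spin R (z u)) x
  <= \sum_(T : {set 'I_n} | u \in T)
       `|fh T| * (2 ^+ #|(T :\ u) :\: S|.+1 * nu J h g u ((T :\ u) :\: S) S).
Proof.
under eq_bigr do rewrite condcov_sum mulr_sumr.
rewrite exchange_big /=; apply: ler_sum => T uT.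
apply: (@le_trans _ _ (`|fh T| * (\sum_x P x *
    `|condcov S (chi R ((T :\ u) :\: S)) (fun z => spin R (z u)) x|))).
  rewrite mulr_sumr; apply: ler_sum => x _.
  rewrite condcov_scale -norm_condcov_chi.
  move: (fh T) (condcov _ _ _ _) (P x) (PX_gt0 J h g x) => a b q q0.
  by rewrite mulrCA; apply: le_trans (ler_norm _) _; rewrite !normrM (gtr0_norm q0).
by apply: ler_wpM2l => //; apply: sum_condcov_chi_le_nu.
Qed.

(** The conditional mean of [X_u] given all other spins is [tanhR (field u x)]; concretely, the
    difference of the two summands is odd under the flip at [u]. *)
Lemma sum_spin_tanh u phi :
  (forall x, phi (flip u x) = phi x) ->
  \sum_x P x * (phi x * spin R (x u)) = \sum_x P x * (phi x * tanhR (field u x)).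
Proof.
move=> inv.
suff : \sum_x P x * (phi x * (spin R (x u) - tanhR (field u x))) = 0.
  under eq_bigr do rewrite mulrBr mulrBr.
  by rewrite sumrB => /eqP; rewrite subr_eq0 => /eqP.
apply: (sum_flip_odd (i := u)) => x.
rewrite PX_flip inv local_field_flip_same flip_same spinN /tanhR.
set t := field u x.
have E0 : expR t != 0 by rewrite gt_eqF ?expR_gt0.
have E1 : expR t * expR t + 1 != 0.
  by rewrite gt_eqF // ltr_pwDr // ?mulr_ge0 ?expR_ge0.
have E2 : expR (2 * t) = expR t * expR t by rewrite mulr_natl mulr2n expRD.
case: (x u); rewrite /spin.
  rewrite mulr1 !expRN E2; field; rewrite ?E0 ?E1 //.
rewrite mulrN1 mulNr opprK E2 !expRN; field; rewrite ?E0 ?E1 //.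
Qed.

(** Replace the spin by [tanhR (field u x)], subtract [tanhR (c x)] at no cost, and apply
    [tanhR_expansive] pointwise. *)
Lemma sum_condcov_field_ge S u :
  u \notin S ->
  2^-1 * expR (- (2 * gam)) * (\sum_x P x * (field u x - condE S (field u) x) ^+ 2)
  <= \sum_x P x * condcov S (field u) (fun z => spin R (z u)) x.
Proof.
move=> uS; set c := condE S (field u).
(* This is where [u \notin S] enters: [c] depends on [X_S] only. *)
have cflip x : c (flip u x) = c x.
  by apply: condE_class; rewrite ev_S_flip // ev_S_refl.
have cle x : `|c x| <= gam.
  have p0 := probX_ev_S_gt0 S x.
  rewrite /c /condE normrM normfV (gtr0_norm p0) ler_pdivrMr // /probX mulr_sumr.
  apply: le_trans (ler_norm_sum _ _ _) _; apply: ler_sum => z _.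
  move: (P z) (PX_gt0 J h g z) (local_field_le J h g u z) => q q0 le.
  by rewrite normrM gtr0_norm // mulrC; apply: ler_wpM2r; rewrite // ltW.
rewrite sum_condcov -/c (@sum_spin_tanh u (fun x => field u x - c x)); last first.
  by move=> x; rewrite cflip local_field_flip_same.
have centred : \sum_x P x * ((field u x - c x) * tanhR (c x)) = 0.
  have tS x z : ev_S S x z -> tanhR (c z) = tanhR (c x).
    by move=> xz; congr tanhR; apply: condE_class.
  rewrite (eq_bigr (fun x => P x * (tanhR (c x) * field u x)
      - P x * (tanhR (c x) * c x))); last by move=> x _; ring.
  by rewrite sumrB -(sum_condE _ tS) subrr.
rewrite -[leRHS]subr0 -[X in _ <= _ - X]centred -sumrB mulr_sumr; apply: ler_sum => x _.
rewrite -mulrBr -mulrBr mulrCA; apply: ler_wpM2l; first exact/ltW/PX_gt0.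
by apply: tanhR_expansive; rewrite ?local_field_le.
Qed.

(** Since [i] is outside [S], [c] agrees at [x] and its flip. One factor 1/2 comes from averaging
    over this pair, the other from [(a - b)^2 <= 2 (a - c)^2 + 2 (b - c)^2], and the exponential
    from comparing the masses of the pair. *)
Lemma sum_sqr_sub_ge_flip S i phi c :
  i \notin S -> (forall x z, ev_S S x z -> c z = c x) ->
  4^-1 * expR (- (2 * gam)) * (\sum_x P x * (phi x - phi (flip i x)) ^+ 2)
  <= \sum_x P x * (phi x - c x) ^+ 2.
Proof.
move=> iS cS.
have e : \sum_x P x * (phi x - c x) ^+ 2
    = 2^-1 * \sum_x (P x * (phi x - c x) ^+ 2 + P (flip i x) * (phi (flip i x) - c x) ^+ 2).
  rewrite big_split /= -[X in _ * (_ + X)](sum_flip i).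
  have -> : \sum_x P (flip i (flip i x)) * (phi (flip i (flip i x)) - c (flip i x)) ^+ 2
      = \sum_x P x * (phi x - c x) ^+ 2.
    apply: eq_bigr => x _; rewrite flipK (cS x (flip i x)) //.
    by rewrite ev_S_flip // ev_S_refl.
  by lra.
rewrite e !mulr_sumr; apply: ler_sum => x _.
have e1 : expR (- (2 * gam)) * P x <= P (flip i x).
  by rewrite expRN ler_pdivrMl ?expR_gt0 //; apply: PX_flip_le.
have e2 : expR (- (2 * gam)) <= 1.
  by rewrite -[leRHS]expR0 ler_expR oppr_le0 mulr_ge0 // (gamma_ge0 _ _ _ i).
have e3 : 0 < expR (- (2 * gam)) by rewrite expR_gt0.
have p := PX_gt0 J h g x.
set E := expR _ in e1 e2 e3 *; set a := phi x; set b := phi (flip i x).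
have H : (a - b) ^+ 2 <= 2 * (a - c x) ^+ 2 + 2 * (b - c x) ^+ 2.
  by have := sqr_ge0 (a + b - 2 * c x); rewrite !expr2; lra.
have h1 : E * P x * (a - c x) ^+ 2 <= P x * (a - c x) ^+ 2.
  by apply: ler_wpM2r; rewrite ?sqr_ge0 //; nra.
have h2 : E * P x * (b - c x) ^+ 2 <= P (flip i x) * (b - c x) ^+ 2.
  by apply: ler_wpM2r; rewrite ?sqr_ge0.
have h3 : E * P x * (a - b) ^+ 2 <= E * P x * (2 * (a - c x) ^+ 2 + 2 * (b - c x) ^+ 2).
  by apply: ler_wpM2l => //; rewrite mulr_ge0 // ltW.
nra.
Qed.

End Conditioning.

(** * Discrepancies as mixtures over latent configurations *)

Section LatentMixture.
Variables (R : realType) (n m : nat) (J : 'M[R]_(n, m)).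
Variables (h : 'I_n -> R) (g : 'I_m -> R).
Implicit Types (x z G : obs n) (y : lat m) (u i j : 'I_n) (S T I : {set 'I_n}).

Local Notation P := (PX J h g).
Local Notation w := (rbm_weight J h g).
Local Notation N := (mrf_nbhd J h g).
Local Notation disc := (discrepancy J h g).

Definition latent_field i y : R := h i + \sum_k J i k * spin R (y k).

(** The law of [X_i] given the latent configuration [y]. *)
Definition cond_spin_prob i y (b : bool) : R :=
  expR (spin R b * latent_field i y)
  / (expR (latent_field i y) + expR (- latent_field i y)).

Lemma cond_spin_prob_bounds i y b : 0 <= cond_spin_prob i y b <= 1.
Proof.
have p : 0 < expR (latent_field i y) + expR (- latent_field i y).
  by rewrite addr_gt0 ?expR_gt0.
rewrite /cond_spin_prob divr_ge0 ?expR_ge0 ?(ltW p) //= ler_pdivrMr // mul1r.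
have := expR_ge0 (latent_field i y); have := expR_ge0 (- latent_field i y).
by case: b; rewrite /spin ?mul1r ?mulN1r; lra.
Qed.

Lemma rbm_weightE x y :
  w x y = expR (\sum_i spin R (x i) * latent_field i y + \sum_k g k * spin R (y k)).
Proof.
rewrite /rbm_weight; congr expR; congr (_ + _); rewrite -big_split /=.
apply: eq_bigr => i _; rewrite mulrDr addrC mulr_sumr mulrC; congr (_ + _).
by apply: eq_bigr => k _; rewrite mulrA.
Qed.

Lemma rbm_weight_flip i x y :
  w (flip i x) y = w x y * expR (- (2 * (spin R (x i) * latent_field i y))).
Proof.
rewrite !rbm_weightE -expRD; congr expR.
rewrite (bigD1 i) //= [in RHS](bigD1 i) //= flip_same spinN.
under eq_bigr => j ji do rewrite flip_other //.
by ring.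
Qed.

(** A flip at [i] preserves [B] and multiplies the weight by a factor depending only on [z i] and
    [y], which fixes the ratio of the two halves of the sum. *)
Lemma sum_weight_spin (B : pred (obs n)) i y b :
  (forall z, B (flip i z) = B z) ->
  \sum_(z | B z && (z i == b)) w z y = cond_spin_prob i y b * \sum_(z | B z) w z y.
Proof.
move=> inv; rewrite [in RHS](bigID (fun z => z i == b)) /=.
rewrite -[X in _ = _ * (_ + X)](sum_flip_cond i).
have -> : \sum_(z | B (flip i z) && (flip i z i != b)) w (flip i z) y
    = expR (- (2 * (spin R b * latent_field i y))) * \sum_(z | B z && (z i == b)) w z y.
  rewrite mulr_sumr; apply: eq_big => z.
    by rewrite inv flip_same; case: (z i); case: b.
  rewrite inv flip_same rbm_weight_flip => /andP[_ e].
  have -> : z i = b by move: e; case: (z i); case: b.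
  by rewrite mulrC.
set A := \sum_(z | _) _; set t := latent_field i y; rewrite /cond_spin_prob -/t.
have E0 : expR t != 0 by rewrite gt_eqF ?expR_gt0.
have E1 : expR t * expR t + 1 != 0.
  by rewrite gt_eqF // ltr_pwDr // ?mulr_ge0 ?expR_ge0.
have E2 : expR (2 * t) = expR t * expR t by rewrite mulr_natl mulr2n expRD.
case: b @A => A; rewrite /spin.
  by rewrite mul1r !expRN E2; field; rewrite ?E0 ?E1.
by rewrite mulN1r mulrN opprK E2 !expRN; field; rewrite ?E0 ?E1.
Qed.

Lemma ev_I_setU1 i T G z : ev_I (i |: T) G z = ev_I T G z && (z i == G i).
Proof.
apply/forall_inP/andP => [H|[/forall_inP H e] k].
  by split; [apply/forall_inP => k kT|]; apply: H; rewrite !inE ?kT ?eqxx ?orbT.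
by rewrite !inE => /predU1P[-> //|/H].
Qed.

(** Conditional independence of the observed spins given [y], obtained by splitting off one
    coordinate at a time. *)
Lemma sum_weight_ev_I (B : pred (obs n)) T G y :
  (forall i z, i \in T -> B (flip i z) = B z) ->
  \sum_(z | B z && ev_I T G z) w z y
  = \prod_(i in T) cond_spin_prob i y (G i) * \sum_(z | B z) w z y.
Proof.
move: {2}#|T| (erefl #|T|) => t; elim: t T B => [|t IH] T B Tt inv.
  have -> : T = set0 by apply/eqP; rewrite -cards_eq0 Tt.
  rewrite big_set0 mul1r; apply: eq_bigl => z; rewrite andbC.
  by rewrite (_ : ev_I _ _ _) //; apply/forall_inP => k; rewrite inE.
have [i iT] : exists i, i \in T by apply/set0Pn; rewrite -cards_eq0 Tt.
have Tit : #|T :\ i| = t by move: (cardsD1 i T); rewrite iT Tt => -[].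
rewrite (big_setD1 i iT) /= -mulrA -IH //; last first.
  by move=> k z; rewrite !inE => /andP[_]; apply: inv.
rewrite -sum_weight_spin => [|z].
  by apply: eq_bigl => z; rewrite -{1}(setD1K iT) ev_I_setU1 andbA.
rewrite inv //; congr (_ && _); apply: eq_forallb_in => k; rewrite !inE => /andP[ki _].
by rewrite flip_other.
Qed.

Lemma probX_ev_I (B : pred (obs n)) T G :
  (forall i z, i \in T -> B (flip i z) = B z) ->
  probX J h g (fun z => B z && ev_I T G z)
  = \sum_y (\sum_(z | B z) w z y) / rbm_Z J h g
      * \prod_(i in T) cond_spin_prob i y (G i).
Proof.
move=> inv; rewrite /probX /PX -mulr_suml exchange_big /=.
under eq_bigr do rewrite sum_weight_ev_I //.
by rewrite mulr_suml; apply: eq_bigr => y _; rewrite -mulrA mulrC.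
Qed.

(** The covariance, given [X_S], of the events [X_u = r] and [Y = y]. It may be negative, and it
    depends neither on [T] nor on [G]. *)
Definition latent_weight S u (r : bool) x y : R :=
  ((\sum_(z | ev_u u r z && ev_S S x z) w z y) / rbm_Z J h g
   - condX J h g (ev_u u r) (ev_S S x) * ((\sum_(z | ev_S S x z) w z y) / rbm_Z J h g))
  / probX J h g (ev_S S x).

Lemma discrepancy_latent S u T r G x :
  u \notin T -> [disjoint T & S] ->
  disc S u T r G x
  = \sum_y latent_weight S u r x y * \prod_(i in T) cond_spin_prob i y (G i).
Proof.
move=> uT TS.
have invS i z : i \in T -> ev_S S x (flip i z) = ev_S S x z.
  by move=> iT; rewrite ev_S_flip // (disjointFr TS).
have e1 : condX J h g (fun z => ev_u u r z && ev_I T G z) (ev_S S x)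
    = (\sum_y (\sum_(z | ev_u u r z && ev_S S x z) w z y) / rbm_Z J h g
        * \prod_(i in T) cond_spin_prob i y (G i)) / probX J h g (ev_S S x).
  rewrite -(probX_ev_I (B := fun z => ev_u u r z && ev_S S x z)); last first.
    move=> i z iT; rewrite invS // /ev_u flip_other //.
    by apply: contraNneq uT => ->.
  by congr (_ / _); apply: eq_bigl => z; rewrite andbAC.
have e2 : condX J h g (ev_I T G) (ev_S S x)
    = (\sum_y (\sum_(z | ev_S S x z) w z y) / rbm_Z J h g
        * \prod_(i in T) cond_spin_prob i y (G i)) / probX J h g (ev_S S x).
  rewrite -(probX_ev_I (B := ev_S S x)) //.
  by congr (_ / _); apply: eq_bigl => z; rewrite andbC.
rewrite /discrepancy e1 e2 mulrA mulr_sumr -mulrBl -sumrB mulr_suml.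
apply: eq_bigr => y _; rewrite /latent_weight; ring.
Qed.

Definition latent_nbhd u : {set 'I_m} := [set k | [exists i in N u, J i k != 0]].

Lemma card_latent_nbhd u : (#|latent_nbhd u| <= rbm_s J h g)%N.
Proof.
exact: (leq_bigmax_cond (F := fun u => #|[set k | [exists i in N u, J i k != 0]]|)).
Qed.

(** Encodes a latent configuration by its set of positive spins, so that subsets of [latent_nbhd u]
    index the mixture components. *)
Definition lat_of_set (A : {set 'I_m}) : lat m := [ffun k => k \in A].

Lemma latent_field_restrict u i y :
  i \in N u ->
  latent_field i y = latent_field i (lat_of_set [set k in latent_nbhd u | y k]).
Proof.
move=> iN; congr (_ + _); apply: eq_bigr => k _; rewrite ffunE !inE.
have [->|Jk] := eqVneq (J i k) 0; first by rewrite !mul0r.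
by rewrite (_ : [exists i in N u, J i k != 0]) //; apply/exists_inP; exists i.
Qed.

(** For [i] in [N u] the factors see [y] only through [latent_nbhd u]; grouping the [y] by this
    restriction and adding their weights leaves at most [2 ^ s] components. *)
Lemma discrepancy_mixture S u T r G x :
  T \subset N u -> [disjoint T & S] ->
  disc S u T r G x
  = mixture
      (fun A => \sum_(y : lat m | [set k in latent_nbhd u | y k] == A)
                  latent_weight S u r x y)
      (fun A i => cond_spin_prob i (lat_of_set A) (G i)) (powerset (latent_nbhd u)) T.
Proof.
move=> TN TS; rewrite discrepancy_latent //; last first.
  by apply/negP => /(subsetP TN); rewrite inE eqxx.
rewrite (partition_big (fun y : lat m => [set k in latent_nbhd u | y k])
  (mem (powerset (latent_nbhd u)))) /=; last first.
  by move=> y _; rewrite inE; apply/subsetP => k; rewrite !inE => /andP[].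
apply: eq_bigr => A _; rewrite mulr_suml; apply: eq_bigr => y /eqP <-.
congr (_ * _); apply: eq_bigr => i iT.
by rewrite /cond_spin_prob -(latent_field_restrict y (subsetP TN i iT)).
Qed.

(** The sum over small subsets serves as [eps]: unlike a maximum, it commutes with the later
    averaging over [r], [G] and [x]. *)
Lemma discrepancy_le_small_subsets S u I r G x d :
  I \subset N u -> [disjoint I & S] -> (#|I| < d)%N ->
  `|disc S u I r G x| <= (2 * d%:R) ^+ (2 ^ rbm_s J h g) *
    \sum_(T : {set 'I_n} | (T \subset I) && (#|T| <= 2 ^ rbm_s J h g)%N)
      `|disc S u T r G x|.
Proof.
move=> IN IS Id; set k := (2 ^ _)%N; set e := \sum_(T | _) _.
have e0 : 0 <= e by apply: sumr_ge0 => T _; apply: normr_ge0.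
have ck : (#|powerset (latent_nbhd u)| <= k)%N.
  by rewrite card_powerset leq_pexp2l // card_latent_nbhd.
have d1 : (1 : R) <= 2 * d%:R by rewrite -[leLHS]/(1%:R) -natrM ler_nat; lia.
apply: (@le_trans _ _ ((2 * d%:R) ^+ #|powerset (latent_nbhd u)| * e)); last first.
  by apply: ler_wpM2r => //; apply: ler_weXn2l.
rewrite discrepancy_mixture //; apply: mixture_le_small_subsets => //.
  by move=> A i; apply: cond_spin_prob_bounds.
move=> T TI Tk; rewrite -discrepancy_mixture; last 2 first.
- exact: subset_trans IN.
- exact: disjointWl IS.
rewrite /e (bigD1 T) /=; last by rewrite TI (leq_trans (ltnW Tk)).
by rewrite lerDl sumr_ge0.
Qed.

Lemma nu_ge0 u I S : 0 <= nu J h g u I S.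
Proof.
rewrite /nu mulr_ge0 ?mulr_ge0 ?invr_ge0 ?exprn_ge0 //.
apply: sumr_ge0 => r _; apply: sumr_ge0 => G _; apply: sumr_ge0 => x _.
by rewrite mulr_ge0 // ltW // PX_gt0.
Qed.

Lemma nu_le_small_subsets S u I d :
  I \subset N u -> [disjoint I & S] -> (#|I| < d)%N ->
  nu J h g u I S <= (2 * d%:R) ^+ (2 ^ rbm_s J h g) *
    \sum_(T : {set 'I_n} | (T \subset I) && (#|T| <= 2 ^ rbm_s J h g)%N)
      nu J h g u T S.
Proof.
move=> IN IS Id; rewrite /nu -mulr_sumr mulrCA; apply: ler_wpM2l.
  by rewrite mulr_ge0 ?invr_ge0 ?exprn_ge0.
rewrite [X in _ <= _ * X]exchange_big mulr_sumr; apply: ler_sum => r _.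
rewrite [X in _ <= _ * X]exchange_big mulr_sumr; apply: ler_sum => G _.
rewrite [X in _ <= _ * X]exchange_big mulr_sumr; apply: ler_sum => x _.
rewrite -[X in _ <= _ * X]mulr_sumr [leRHS]mulrCA; apply: ler_wpM2l; first exact/ltW/PX_gt0.
exact: discrepancy_le_small_subsets.
Qed.

(** Take the small subset of largest [nu]; there are at most [2 ^ #|I| <= 2 ^ d] candidates. *)
Lemma nu_small_subset S u I d :
  I \subset N u -> [disjoint I & S] -> (#|I| < d)%N ->
  exists T : {set 'I_n},
    [/\ T \subset I, (#|T| <= 2 ^ rbm_s J h g)%N &
     nu J h g u I S <= (2 * d%:R) ^+ (2 ^ rbm_s J h g) * (2 ^+ d * nu J h g u T S)].
Proof.
move=> IN IS Id.
pose small := [pred T : {set 'I_n} | (T \subset I) && (#|T| <= 2 ^ rbm_s J h g)%N].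
have s0 : small set0 by rewrite /= sub0set cards0.
pose T := [arg max_(T > set0 | small T) nu J h g u T S]%O.
have [TI Tk Tmax] : [/\ T \subset I, (#|T| <= 2 ^ rbm_s J h g)%N &
    forall T', small T' -> nu J h g u T' S <= nu J h g u T S].
  by rewrite /T; case: arg_maxP => // T' /andP[].
exists T; split=> //; apply: le_trans (nu_le_small_subsets IN IS Id) _.
apply: ler_wpM2l; first by rewrite exprn_ge0 // mulr_ge0.
apply: (@le_trans _ _ (\sum_(T' in small) nu J h g u T S)).
  by apply: ler_sum => T' /Tmax.
rewrite sumr_const -[leLHS]mulr_natl; apply: ler_wpM2r; first exact: nu_ge0.
rewrite -natrX ler_nat; apply: (@leq_trans (2 ^ #|I|)); last by rewrite leq_pexp2l // ltnW.
rewrite -card_powerset; apply: subset_leq_card; apply/subsetP => T'.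
by rewrite !inE => /andP[].
Qed.

End LatentMixture.

(** * Influential subsets *)

Section InfluentialSubset.
Variables (R : realType) (n m : nat) (J : 'M[R]_(n, m)).
Variables (h : 'I_n -> R) (g : 'I_m -> R).
Implicit Types (x z : obs n) (u i j : 'I_n) (S T I : {set 'I_n}).

Local Notation P := (PX J h g).
Local Notation fh := (fhat J h g).
Local Notation gam := (rbm_gamma J h g).
Local Notation N := (mrf_nbhd J h g).
Local Notation field := (local_field J h g).

(** The exponent collects [rbm_D] factors from the passage to the uniform measure, one from the flip
    at [i] and one from the hyperbolic tangent; the constant is [1/2 * 1/4 * 4]. *)
Lemma sum_condcov_field_ge_fhat S u i T :
  u \notin S -> i \notin S -> u \in T -> i \in T -> i != u ->
  2^-1 * fh T ^+ 2 * expR (- (2 * gam)) ^+ (rbm_D J h g + 2)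
  <= \sum_x P x * condcov J h g S (field u) (fun z => spin R (z u)) x.
Proof.
move=> uS iS uT iT iu.
set E := expR (- (2 * gam)).
have g0 : 0 <= gam := gamma_ge0 J h g u.
have E0 : 0 <= E by exact: expR_ge0.
have E1 : E <= 1 by rewrite /E -[leRHS]expR0 ler_expR oppr_le0 mulr_ge0.
have ND : (#|N u| <= rbm_D J h g)%N.
  exact: (leq_bigmax_cond (F := fun u => #|N u|)).
pose phi x := (field u x - field u (flip i x)) ^+ 2.
have H1 : 4 * fh T ^+ 2 * E ^+ #|N u| <= \sum_x P x * phi x.
  have inv j x : j \notin enum (N u) -> phi (flip j x) = phi x.
    rewrite mem_enum /phi (flipC i) => jN.
    have [->|ju] := eqVneq j u; first by rewrite !local_field_flip_same.
    by rewrite !(local_field_flip_out (j := j)).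
  have := expectation_ge_uniform g0 (fun x => sqr_ge0 _ : 0 <= phi x) inv.
  rewrite -cardE -/E; apply: le_trans; rewrite mulrC.
  by apply: ler_wpM2l; [exact: exprn_ge0 | exact: sum_sqr_flip_local_field_ge].
have H2 := sum_sqr_sub_ge_flip J h g (field u) iS (@condE_class _ _ _ J h g S (field u)).
have H3 := sum_condcov_field_ge J h g uS.
have {}H1 : 4 * fh T ^+ 2 * E ^+ rbm_D J h g <= \sum_x P x * phi x.
  apply: le_trans H1; apply: ler_wpM2l; first by rewrite mulr_ge0 ?sqr_ge0.
  by apply: ler_wiXn2l.
apply: le_trans H3; rewrite -/E exprD expr2.
have {}H2 := le_trans (ler_wpM2l (mulr_ge0 _ E0) H1) H2.
apply: le_trans (ler_wpM2l _ (H2 _)); rewrite ?mulr_ge0 ?invr_ge0 //.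
have aux (a b e : R) :
    2^-1 * a * (b * (e * e)) = 2^-1 * e * (4^-1 * e * (4 * a * b)) by field.
by rewrite aux.
Qed.

Lemma card_order_le T : (1 < rbm_d J)%N -> fh T != 0 -> (#|T| <= rbm_d J)%N.
Proof.
move=> d2 fT; rewrite leqNgt; apply: contra fT => dT.
by rewrite fhat_eq0_of_order // (ltn_trans d2).
Qed.

(** Choose the term with nonzero coefficient whose [nu] is largest; the absolute coefficients sum to
    at most [gam]. Removing [u] from a set of at most [rbm_d J] elements absorbs the extra 1 in the
    exponent of 2. *)
Lemma exists_influential_term S u T0 :
  (1 < rbm_d J)%N -> u \in T0 -> fh T0 != 0 ->
  exists T, [/\ u \in T, fh T != 0 &
    \sum_x P x * condcov J h g S (field u) (fun z => spin R (z u)) x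
    <= gam * (2 ^+ rbm_d J * nu J h g u ((T :\ u) :\: S) S)].
Proof.
move=> d2 uT0 fT0.
pose ok := [pred T : {set 'I_n} | (u \in T) && (fh T != 0)].
have ok0 : ok T0 by rewrite /= uT0.
pose T := [arg max_(T > T0 | ok T) nu J h g u ((T :\ u) :\: S) S]%O.
have [uT fT Tmax] : [/\ u \in T, fh T != 0 & forall T', ok T' ->
    nu J h g u ((T' :\ u) :\: S) S <= nu J h g u ((T :\ u) :\: S) S].
  by rewrite /T; case: arg_maxP => // T' /andP[].
exists T; split=> //.
have nu0 := nu_ge0 J h g u ((T :\ u) :\: S) S.
apply: le_trans (sum_condcov_field_le_nu J h g S u) _.
apply: le_trans (ler_wpM2r _ (fhat_sum_le_gamma J h g u)); last first.
  by rewrite mulr_ge0 ?exprn_ge0.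
rewrite mulr_suml; apply: ler_sum => T' uT'.
have [->|fT'] := eqVneq (fh T') 0; first by rewrite normr0 !mul0r.
apply: ler_wpM2l => //; apply: ler_pM; rewrite ?exprn_ge0 ?nu_ge0 //.
  apply: ler_weXn2l; first by rewrite ler1n.
  apply: leq_trans (card_order_le d2 fT').
  by rewrite (cardsD1 u T') uT' ltnS subset_leq_card // subsetDl.
by apply: Tmax; rewrite /= uT'.
Qed.

End InfluentialSubset.

(** * Comparison of constants and conclusion *)

(** Here [E] stands for [expR (- (2 * gamma))]. The right side is what the argument yields; the left
    side is compared with it factor by factor. *)
Lemma constant_le (R : realFieldType) (d D k C : nat) (gamma zeta E : R) :
  (1 < d)%N -> 0 < gamma -> 0 < E -> E <= 1 ->
  ((4 * d%:R) ^+ k)^-1 * (d%:R^-1) ^+ (k * (k + 1))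
  * (4 * zeta ^+ 2 * E ^+ (d + D - 1)
     / (d%:R ^+ (4 * d) * 2 ^+ (d + 1) * C%:R * gamma * E^-1))
  <= 2^-1 * zeta ^+ 2 * E ^+ (D + 2)
     / (gamma * 2 ^+ d * (2 * d%:R) ^+ k * 2 ^+ d).
Proof.
move=> d2 gam0 E0 E1.
have dR : (2 : R) <= d%:R by rewrite ler_nat.
have d0 : (0 : R) < d%:R by rewrite ltr0n ltnW.
have f1 : ((4 * d%:R) ^+ k)^-1 <= ((2 * d%:R) ^+ k)^-1 :> R.
  rewrite lef_pV2 ?posrE ?exprn_gt0 ?mulr_gt0 //.
  by apply: lerXn2r; rewrite ?nnegrE ?mulr_ge0 ?ltW //; lra.
have f2 : (d%:R^-1) ^+ (k * (k + 1)) <= 1 :> R.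
  by rewrite exprn_ile1 ?invr_ge0 ?(ltW d0) // invf_le1 //; lra.
(* For [C = 0] the inverse is 0 by convention. *)
have f3 : C%:R^-1 <= 1 :> R.
  by case: C => [|c]; rewrite ?invr0 // invf_le1 ?ltr0n // ler1n.
have f4 : 4 / (d%:R ^+ (4 * d) * 2 ^+ (d + 1)) <= 2^-1 / (2 ^+ d * 2 ^+ d) :> R.
  rewrite ler_pdivrMr ?mulr_gt0 ?exprn_gt0 // mulrAC ler_pdivlMr ?mulr_gt0 ?exprn_gt0 //.
  have a1 : 2 ^+ (4 * d) <= d%:R ^+ (4 * d) :> R.
    by apply: lerXn2r; rewrite ?nnegrE ?ler0n.
  have a2 : 2 ^+ (d + 1) * 2 ^+ (4 * d) <= d%:R ^+ (4 * d) * 2 ^+ (d + 1) :> R.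
    by rewrite mulrC; apply: ler_wpM2r; rewrite ?exprn_ge0.
  have a3 : 2 ^+ (d + d + 3) <= 2 ^+ (d + 1) * 2 ^+ (4 * d) :> R.
    by rewrite -exprD; apply: ler_weXn2l; [rewrite ler1n | lia].
  rewrite -exprD; move: a3; rewrite exprD; set t := 2 ^+ (d + d) => a3.
  have e8 : (2 : R) ^+ 3 = 8 by rewrite -natrX.
  rewrite e8 in a3; lra.
(* As [2 <= d], the total exponent [d + D] is at least [D + 2], and [E <= 1]. *)
have f5 : E ^+ (d + D - 1) * E <= E ^+ (D + 2).
  rewrite -exprSr; apply: ler_wiXn2l; rewrite ?(ltW E0) //; lia.
have -> : ((4 * d%:R) ^+ k)^-1 * (d%:R^-1) ^+ (k * (k + 1))
    * (4 * zeta ^+ 2 * E ^+ (d + D - 1)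
       / (d%:R ^+ (4 * d) * 2 ^+ (d + 1) * C%:R * gamma * E^-1))
  = (((4 * d%:R) ^+ k)^-1 * ((d%:R^-1) ^+ (k * (k + 1)) * C%:R^-1))
    * (4 / (d%:R ^+ (4 * d) * 2 ^+ (d + 1)) * (E ^+ (d + D - 1) * E))
    * (zeta ^+ 2 / gamma).
  by rewrite !invfM invrK; ring.
have -> : 2^-1 * zeta ^+ 2 * E ^+ (D + 2) / (gamma * 2 ^+ d * (2 * d%:R) ^+ k * 2 ^+ d)
  = (((2 * d%:R) ^+ k)^-1 * 1) * (2^-1 / (2 ^+ d * 2 ^+ d) * E ^+ (D + 2))
    * (zeta ^+ 2 / gamma).
  by rewrite !invfM; ring.
have p1 : 0 <= d%:R^-1 :> R by rewrite invr_ge0 ltW.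
apply: ler_wpM2r; first by rewrite divr_ge0 ?sqr_ge0 ?ltW.
have C0 : 0 <= C%:R^-1 :> R by rewrite invr_ge0 ler0n.
have q0 : 0 <= ((4 * d%:R) ^+ k)^-1 :> R.
  by rewrite invr_ge0 exprn_ge0 // mulr_ge0 // ler0n.
have q1 : 0 <= 4 / (d%:R ^+ (4 * d) * 2 ^+ (d + 1)) :> R.
  by rewrite divr_ge0 // mulr_ge0 ?exprn_ge0 ?ler0n.
have q2 : 0 <= E ^+ (d + D - 1) * E by rewrite mulr_ge0 ?exprn_ge0 // ltW.
have q3 : 0 <= d%:R^-1 ^+ (k * (k + 1)) :> R by rewrite exprn_ge0.
apply: ler_pM; [by rewrite !mulr_ge0 | by rewrite mulr_ge0 | | exact: ler_pM].
apply: ler_pM => //; first by rewrite mulr_ge0.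
by rewrite -[leRHS]mul1r; apply: ler_pM.
Qed.

Theorem theorem7 (R : realType) (n m : nat) (J : 'M[R]_(n, m))
  (h : 'I_n -> R) (g : 'I_m -> R) (zeta : R) (u : 'I_n) (S : {set 'I_n}) :
  0 < zeta ->
  u \notin S ->
  (exists i : 'I_n, [/\ i \in mrf_nbhd J h g u, i \notin S &
     exists T : {set 'I_n}, [/\ u \in T, i \in T & zeta <= `|fhat J h g T|]]) ->
  let d := rbm_d J in
  let s := rbm_s J h g in
  let D := rbm_D J h g in
  let gamma := rbm_gamma J h g in
  exists I : {set 'I_n},
    [/\ I \subset mrf_nbhd J h g u, [disjoint I & S], (#|I| <= 2 ^ s)%N &
    ((4 * d%:R) ^+ (2 ^ s))^-1 * (d%:R^-1) ^+ (2 ^ s * (2 ^ s + 1))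
    * (4 * zeta ^+ 2 * (expR (- (2 * gamma))) ^+ (d + D - 1)
       / ((d%:R) ^+ (4 * d) * 2 ^+ (d + 1) * ('C(D, d - 1))%:R * gamma
          * expR (2 * gamma)))
    <= nu J h g u I S].
Proof.
move=> z0 uS [i [iN iS [T0 [uT0 iT0 zT0]]]] d s D gamma.
have iu : i != u by move: iN; rewrite inE => /andP[].
have fT0 : fhat J h g T0 != 0 by rewrite -normr_gt0 (lt_le_trans z0).
have T02 : (1 < #|T0|)%N.
  rewrite (cardsD1 u) uT0 (cardsD1 i) !inE iu iT0; lia.
(* With [d <= 1], the set [T0], which contains both [u] and [i], would have coefficient 0. *)
have d2 : (1 < d)%N.
  rewrite ltnNge; apply: contra fT0 => d1; rewrite fhat_eq0_of_order //.
  exact: leq_ltn_trans T02.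
have low := sum_condcov_field_ge_fhat J h g uS iS uT0 iT0 iu.
have [T [uT fT up]] := exists_influential_term S d2 uT0 fT0.
set V := (T :\ u) :\: S in up.
have VN : V \subset mrf_nbhd J h g u.
  apply/subsetP => j; rewrite !inE => /and3P[_ -> jT] /=.
  by apply/existsP; exists T; rewrite uT jT.
have VS : [disjoint V & S].
  by rewrite disjoints_subset; apply/subsetP => j; rewrite !inE => /andP[].
have Vd : (#|V| < d)%N.
  apply: leq_trans (card_order_le d2 fT).
  by rewrite (cardsD1 u T) uT ltnS subset_leq_card // subsetDl.
have [I [IV Is nuI]] := nu_small_subset VN VS Vd.
exists I; split=> //; first exact: subset_trans VN.
  exact: disjointWl VS.
have gam0 : 0 < gamma.
  apply: lt_le_trans (lt_le_trans z0 zT0) _.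
  apply: le_trans (fhat_sum_le_gamma J h g u).
  by rewrite (bigD1 T0) //= lerDl sumr_ge0.
set E := expR (- (2 * gamma)).
have E0 : 0 < E by exact: expR_gt0.
have E1 : E <= 1 by rewrite /E -[leRHS]expR0 ler_expR oppr_le0 mulr_ge0 // ltW.
rewrite (_ : expR (2 * gamma) = E^-1); last by rewrite /E expRN invrK.
set k := (2 ^ s)%N.
have d0 : (0 : R) < d%:R by rewrite ltr0n ltnW.
(* Chains [zeta <= |fhat T0|], the lower bound [low], the upper bound [up] at [V], and the passage
   from [V] to [I]. *)
have key : 2^-1 * zeta ^+ 2 * E ^+ (D + 2)
    <= gamma * (2 ^+ d * ((2 * d%:R) ^+ k * (2 ^+ d * nu J h g u I S))).
  have up' : gamma * (2 ^+ d * nu J h g u V S)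
      <= gamma * (2 ^+ d * ((2 * d%:R) ^+ k * (2 ^+ d * nu J h g u I S))).
    by apply: ler_wpM2l; [exact: ltW | apply: ler_wpM2l; rewrite ?exprn_ge0].
  apply: le_trans up'; apply: le_trans up; apply: le_trans low.
  apply: ler_wpM2r; first exact/exprn_ge0/ltW.
  apply: ler_wpM2l; first by rewrite invr_ge0.
  by rewrite -[leRHS]real_normK ?num_real // ler_pXn2r // nnegrE ?ltW.
have M0 : 0 < gamma * 2 ^+ d * (2 * d%:R) ^+ k * 2 ^+ d.
  by rewrite !mulr_gt0 ?exprn_gt0 ?mulr_gt0.
have {}key : 2^-1 * zeta ^+ 2 * E ^+ (D + 2) / (gamma * 2 ^+ d * (2 * d%:R) ^+ k * 2 ^+ d)
    <= nu J h g u I S.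
  move: (nu J h g u I S) key => v key; rewrite ler_pdivrMr //.
  by apply: le_trans key _; rewrite [leRHS]mulrC !mulrA.
by apply: le_trans key; apply: constant_le.
Qed.
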